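(* Let $G$ be a graph of order $n$ with a cut edge $v_1v_2\in E(G)$ and let $M=V(G)$. Then $|P(M,v_1v_2)|=2\lfloor \frac{n}{2}\rfloor \lceil \frac{n}{2} \rceil$ if and only if there are two vertex-disjoint subgraphs $G_1$ and $G_2$ of $G$ with $V(G)=V(G_1)\cup V(G_2)$ and $\bigl||V(G_1)|-|V(G_2)|\bigr| \leq 1$, where $v_i\in V(G_i)$ for $i=1,2$, and $G_1$ and $G_2$ are connected by the bridge edge $v_1v_2$.
   Context: Graphs are finite, undirected and simple; the order of a graph is its number of vertices. A cut edge (bridge) is an edge whose deletion increases the number of connected components. ''$G_1$ and $G_2$ are connected by the bridge edge $v_1v_2$'' means that $v_1v_2$ is a bridge of $G$ and is the edge of $G$ joining $V(G_1)$ to $V(G_2)$. $d_G(x,y)$ is the distance between $x$ and $y$ in $G$ ($\infty$ if there is no path), and $G-e$ is the graph obtained from $G$ by deleting the edge $e$. For $M\subseteq V(G)$ and an edge $e$ of $G$, $P(M,e)$ is the set of ordered pairs $(x,y)$ with $x\in M$, $y\in V(G)$ and $d_G(x,y)\neq d_{G-e}(x,y)$.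
   Formalization: The subgraphs G_1 and G_2 are additionally required to be connected; without this the ''if'' direction fails for disconnected G (an edge v_1v_2 plus two isolated vertices, one put in each G_i). For connected G the claim is unchanged. *)

(* Defs.v *)
From mathcomp Require Import all_boot all_order all_algebra.

Set Implicit Arguments.
Unset Strict Implicit.
Unset Printing Implicit Defensive.

Record sgraph (T : finType) := SGraph {
  adj :> rel T;
  adj_sym : symmetric adj;
  adj_irrefl : irreflexive adj }.

Section Graphs.
Variable T : finType.
Implicit Types (G : sgraph T) (e : rel T) (x y u w : T).

Definition del_edge_rel e x y : rel T :=
  fun u w => e u w && ([set u; w] != [set x; y]).

Lemma del_edge_sym G x y : symmetric (del_edge_rel G x y).
Proof. by move=> u w; rewrite /del_edge_rel adj_sym setUC. Qed.

Lemma del_edge_irrefl G x y : irreflexive (del_edge_rel G x y).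
Proof. by move=> u; rewrite /del_edge_rel adj_irrefl. Qed.

Definition del_edge G x y : sgraph T :=
  SGraph (del_edge_sym G x y) (del_edge_irrefl G x y).

Definition walk e (k : nat) x y : bool :=
  [exists p : k.-tuple T, path e x p && (last x p == y)].

Lemma connect_walk e x y : connect e x y -> exists k, walk e k x y.
Proof.
case/connectP=> p ep ->; exists (size p).
by apply/existsP; exists (in_tuple p); rewrite ep eqxx.
Qed.

(* [None] stands for the infinite distance. *)
Definition dist e x y : option nat :=
  match @idP (connect e x y) with
  | ReflectT exy => Some (ex_minn (connect_walk exy))
  | ReflectF _ => None
  end.

Definition num_components G : nat := n_comp G [set: T].

Definition bridge G x y : bool :=
  G x y && (num_components G < num_components (del_edge G x y)).

(* The set P(M, xy) of ordered pairs. *)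
Definition monitored_pairs G (M : {set T}) x y : {set T * T} :=
  [set p | (p.1 \in M) && (dist G p.1 p.2 != dist (del_edge G x y) p.1 p.2)].

(* Not necessarily induced. *)
Record subgraph G := Subgraph {
  sub_vertices : {set T};
  sub_adj : rel T;
  sub_adj_sym : symmetric sub_adj;
  sub_adj_edge : forall u w, sub_adj u w ->
    [/\ u \in sub_vertices, w \in sub_vertices & G u w] }.

Definition sub_connected G (H : subgraph G) : Prop :=
  sub_vertices H != set0 /\
  {in sub_vertices H &, forall u w, connect (sub_adj H) u w}.

(* xy is a bridge, and is the only edge of G between V(G1) and V(G2). *)
Definition connected_by_bridge G (G1 G2 : subgraph G) x y : Prop :=
  [/\ bridge G x y, x \in sub_vertices G1, y \in sub_vertices G2
    & forall u w, u \in sub_vertices G1 -> w \in sub_vertices G2 ->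
        G u w -> u = x /\ w = y].

End Graphs.

(* Main.v *)
(** Let [A] and [B] be the components of [v1] and [v2] after the bridge [v1v2] is
    deleted. A simple path either avoids the bridge, or crosses it exactly once and so
    goes from one of [A], [B] to the other; hence the pairs whose distance changes are
    exactly those of [A x B] and [B x A], and there are [2 |A| |B|] of them. Since
    [|A| + |B| <= n], this equals [2 floor(n/2) ceil(n/2)] iff [A] and [B] cover the
    graph and their sizes differ by at most one. *)

Require Import Defs.
From mathcomp Require Import all_boot all_order all_algebra.
From mathcomp Require Import zify.

Set Implicit Arguments.
Unset Strict Implicit.
Unset Printing Implicit Defensive.

Lemma sqr_add_distn (a b : nat) : (a + b) ^ 2 = 4 * (a * b) + `|a - b|%N ^ 2.
Proof. by case: (leqP a b) => ab; [rewrite distnEr | rewrite distnEl]; nia. Qed.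

(** Compare [(a + b)^2 = 4ab + |a - b|^2] with [n^2 = 4 * (n./2 * uphalf n) + odd n]. The bound
    [1 < n] excludes [n = 1], [a = b = 0], where both products vanish although [a + b < n]. *)
Lemma prod_eq_half_uphalf (a b n : nat) : 1 < n -> a + b <= n ->
  a * b = n./2 * uphalf n <-> a + b = n /\ (`|a - b| <= 1)%N.
Proof.
move=> n_gt1 s_le_n; have := sqr_add_distn a b.
move: (a + b) `|a - b|%N (a * b) s_le_n => s d p s_le_n sdp.
have hn : n ^ 2 = 4 * (n./2 * uphalf n) + odd n.
  rewrite uphalf_half -{1}[n]odd_double_half; case: (odd n) => /=; nia.
have odd_le1 : odd n <= 1 by case: odd.
split=> [p_eq|[sn d_le1]].
  (* If [s <= n - 1], then [n^2 - 1 <= 4p <= s^2 <= (n - 1)^2], which forces [n <= 1]. *)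
  have sn : s = n by nia.
  by split=> //; nia.
have d2 : d ^ 2 <= 1 by nia.
subst s; lia.
Qed.

Section Distance.
Variable T : finType.
Implicit Types (e : rel T) (x y : T).

Lemma walkP e k x y :
  reflect (exists p, [/\ size p = k, path e x p & last x p = y]) (walk e k x y).
Proof.
apply: (iffP existsP) => [[p /andP[ep /eqP lp]]|[p [sz ep lp]]].
  by exists p; rewrite size_tuple.
have szp : size p == k by apply/eqP.
by exists (Tuple szp); rewrite /= ep lp eqxx.
Qed.

Lemma walk_connect e k x y : walk e k x y -> connect e x y.
Proof. by case/walkP=> p [_ ep <-]; apply/connectP; exists p. Qed.

Variant dist_spec e x y : option nat -> Prop :=
  | DistSome k of walk e k x y & (forall j, walk e j x y -> k <= j) :
      dist_spec e x y (Some k)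
  | DistNone of ~~ connect e x y : dist_spec e x y None.

Lemma distP e x y : dist_spec e x y (dist e x y).
Proof.
rewrite /dist; case: {-}_ / idP => [exy|/negP nexy]; last exact: DistNone.
by case: ex_minnP => k wk kmin; apply: DistSome.
Qed.

Lemma dist_connect_neq e e' x y :
  connect e x y -> ~~ connect e' x y -> dist e x y != dist e' x y.
Proof.
move=> exy e'xy; case: distP => [k _ _|]; last by rewrite exy.
by case: distP => // j /walk_connect; rewrite (negPf e'xy).
Qed.

(** The hypotheses are asymmetric because [e] will be [G] and [e'] will be [G] minus the edge: walks
    of the latter carry over unchanged, while walks of [G] may have to be shortened first. *)
Lemma eq_dist_walk e e' x y :
    (forall k, walk e k x y -> exists2 j, j <= k & walk e' j x y) ->
    (forall k, walk e' k x y -> walk e k x y) ->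
  dist e x y = dist e' x y.
Proof.
move=> ee' e'e; case: distP => [k wk kmin|nexy]; case: distP => [j wj jmin|ne'xy] //.
- congr Some; apply/eqP; rewrite eqn_leq kmin ?e'e //=.
  by have [i ik /jmin ji] := ee' _ wk; apply: leq_trans ji ik.
- by have [i _ /walk_connect] := ee' _ wk; rewrite (negPf ne'xy).
- by move/e'e/walk_connect: wj; rewrite (negPf nexy).
Qed.

End Distance.

Section DeletedEdge.
Variables (T : finType) (G : sgraph T) (v1 v2 : T).
Implicit Types x y u w : T.

Let D := del_edge G v1 v2.
Let A := [set u | connect D v1 u].
Let B := [set u | connect D v2 u].

Let symD : connect_sym D.
Proof. exact/sym_connect_sym/adj_sym. Qed.

Lemma sub_del_edge : subrel D G.
Proof. by move=> u w /andP[]. Qed.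

Lemma del_edge_cases u w :
  G u w -> [\/ D u w, u = v1 /\ w = v2 | u = v2 /\ w = v1].
Proof.
move=> Guw; have [Duw|nDuw] := boolP (D u w); first by constructor.
have nuw : u != w by apply: contraTneq Guw => ->; rewrite adj_irrefl.
move: nDuw; rewrite /= /del_edge_rel Guw negbK => /eqP uw.
have := set21 u w; have := set22 u w; rewrite uw !inE.
move=> /pred2P[] ew /pred2P[] eu; subst; rewrite ?eqxx // in nuw *.
  by constructor.
by constructor.
Qed.

(** The deleted edge has [v] as an end, so a path missing [v] cannot use it. *)
Lemma path_avoid_del_edge v x p :
  v \in [set v1; v2] -> v \notin x :: p -> path G x p -> path D x p.
Proof.
move=> v12 vxp; apply: (@sub_in_path _ (predC1 v)).
  move=> a b /= a_v b_v /del_edge_cases[] // [ea eb]; exfalso; subst;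
    by move: v12; rewrite !inE ![v == _]eq_sym (negPf a_v) (negPf b_v).
by apply/allP=> a a_xp; apply: contraNneq vxp => <-.
Qed.

(** Induction on the path. If its first edge is the deleted one, simplicity keeps the rest away from
    [x], hence inside [D]. If the first edge lies in [D], then [x] and [z] are on the same side and
    the induction hypothesis transfers. *)
Lemma simple_path_del_edge x p : path G x p -> uniq (x :: p) ->
  [\/ path D x p, x \in A /\ last x p \in B | x \in B /\ last x p \in A].
Proof.
elim: p x => [|z p IHp] x; first by constructor.
rewrite [path G _ _]/= => /andP[Gxz Gp] /andP[xzp uzp].
have avoid : x \in [set v1; v2] -> connect D z (last z p).
  by move=> /path_avoid_del_edge/(_ xzp Gp) Dp; apply/connectP; exists p.
have [Dxz|[ex ez]|[ex ez]] := del_edge_cases Gxz; last 2 first.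
- by constructor 2; subst; rewrite /= !inE connect0 avoid ?set21.
- by constructor 3; subst; rewrite /= !inE connect0 avoid ?set22.
have extend v : connect D v z -> connect D v x.
  by move=> vz; apply: connect_trans vz _; rewrite symD connect1.
have [Dp|[zs ls]|[zs ls]] := IHp z Gp uzp.
- by constructor 1; apply/andP.
- by constructor 2; move: zs ls; rewrite !inE => /extend.
- by constructor 3; move: zs ls; rewrite !inE => /extend.
Qed.

(** Were [v1] and [v2] still joined in [D], then [G] and [D] would have the same connectivity
    relation, hence equally many components. *)
Lemma bridge_not_connect : bridge G v1 v2 -> ~~ connect D v1 v2.
Proof.
case/andP=> _; apply: contraL => D12.
rewrite -leqNgt /num_components (@eq_n_comp _ G D) // => u w.
apply/idP/idP; last by apply: connect_sub => a b /sub_del_edge/connect1.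
apply: connect_sub => a b /del_edge_cases[/connect1 //|[-> ->] //|[-> ->]].
by rewrite symD.
Qed.

Hypothesis br : bridge G v1 v2.

Lemma disjoint_sides : [disjoint A & B].
Proof.
apply/pred0P=> u /=; rewrite !inE; apply/negP=> /andP[A_u].
by rewrite symD => /(connect_trans A_u); apply/negP/bridge_not_connect.
Qed.

Lemma sides_absurd u : u \in A -> u \in B -> False.
Proof. by move=> uA uB; have /pred0P/(_ u) := disjoint_sides; rewrite /= uA uB. Qed.

(** Across the cut the distance turns from finite to infinite. For any other pair,
    [simple_path_del_edge] places every simple path of [G] inside [D]. *)
Lemma dist_del_edge x y :
  (dist G x y != dist D x y) = (x \in A) && (y \in B) || (x \in B) && (y \in A).
Proof.
have subDG a b : connect D a b -> connect G a b.
  by apply: connect_sub => u w /sub_del_edge/connect1.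
have symG : connect_sym G by apply/sym_connect_sym/adj_sym.
have G12 : connect G v1 v2 by case/andP: br => /connect1.
apply/idP/idP; last first.
  case/orP=> /andP[xA yB]; apply: dist_connect_neq.
  - move: xA yB; rewrite !inE => /subDG xA /subDG yB.
    by rewrite symG in xA; apply: connect_trans xA (connect_trans G12 yB).
  - apply/negP=> Dxy; apply: (@sides_absurd y) => //.
    by move: xA; rewrite !inE => /connect_trans; apply.
  - move: xA yB; rewrite !inE => /subDG xA /subDG yB.
    rewrite symG in xA; apply: connect_trans xA (connect_trans _ yB).
    by rewrite symG.
  apply/negP=> Dxy; apply: (@sides_absurd y) => //.
  by move: xA; rewrite !inE => /connect_trans; apply.
apply: contraR => nxy; apply/eqP/eq_dist_walk => k; last first.
  case/walkP=> p [sz Dp lp]; apply/walkP; exists p; split=> //.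
  exact: sub_path sub_del_edge _ _ Dp.
case/walkP=> p [<- Gp]; case: (shortenP Gp) => q Gq uq qp lq.
(* [q] is duplicate-free with all its vertices in [p], so it is no longer than [p]. *)
exists (size q); first by apply: uniq_leq_size qp; case/andP: uq.
apply/walkP; exists q; split=> //.
case: (simple_path_del_edge Gq uq) => // -[xs]; rewrite lq => ys.
  by rewrite xs ys in nxy.
by rewrite xs ys orbT in nxy.
Qed.

Lemma monitored_pairsE :
  monitored_pairs G [set: T] v1 v2 = setX A B :|: setX B A.
Proof. by apply/setP=> -[x y]; rewrite !inE dist_del_edge !inE. Qed.

Lemma card_monitored_pairs :
  #|monitored_pairs G [set: T] v1 v2| = 2 * (#|A| * #|B|).
Proof.
rewrite monitored_pairsE cardsU.
have -> : setX A B :&: setX B A = set0.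
  apply/setP=> -[x y]; rewrite in_setI !in_setX in_set0.
  apply/negP=> /andP[/andP[xA _] /andP[xB _]].
  exact: sides_absurd xA xB.
by rewrite cards0 subn0 !cardsX [#|B| * _]mulnC addnn mul2n.
Qed.

Lemma cut_edge_across x y :
  x \in A -> y \in B -> G x y -> x = v1 /\ y = v2.
Proof.
move=> xA yB /del_edge_cases[Dxy|//|[ex _]]; exfalso.
  apply: (@sides_absurd y) => //; move: xA; rewrite !inE => /connect_trans.
  by apply; apply: connect1.
by apply: (@sides_absurd v2); [rewrite -ex | rewrite inE].
Qed.

End DeletedEdge.

Section Component.
Variables (T : finType) (G H : sgraph T) (v : T).
Hypothesis subHG : subrel H G.

Let C := [set u | connect H v u].
Let comp_adj : rel T := fun u w => [&& H u w, u \in C & w \in C].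

Fact comp_adj_sym : symmetric comp_adj.
Proof. by move=> u w; rewrite /comp_adj adj_sym [(u \in C) && _]andbC. Qed.

Fact comp_adj_edge u w : comp_adj u w -> [/\ u \in C, w \in C & G u w].
Proof. by case/and3P=> /subHG. Qed.

(** A component of [H], viewed as a subgraph of the larger graph [G]; [H] will be [G] minus the
    bridge. *)
Definition component : subgraph G := Subgraph comp_adj_sym comp_adj_edge.

Lemma component_connected : sub_connected component.
Proof.
have csym : connect_sym comp_adj by apply/sym_connect_sym/comp_adj_sym.
split=> [|u w]; first by apply/set0Pn; exists v; rewrite inE.
suff root x : x \in C -> connect comp_adj v x.
  by move=> /root uC /root wC; apply: connect_trans wC; rewrite csym.
rewrite inE => /connectP[p Hp ->] {x}.
elim/last_ind: p Hp => [|p x IHp]; first by rewrite connect0.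
rewrite rcons_path last_rcons => /andP[Hp Hx].
apply: connect_trans (IHp Hp) (connect1 _).
have lC : connect H v (last v p) by apply/connectP; exists p.
by rewrite /comp_adj Hx !inE lC (connect_trans lC) ?connect1.
Qed.

End Component.

(** A subgraph missing an end of [v1v2] does not contain that edge, so its connections survive the
    deletion. This confines [G1] and [G2] to the two sides of the cut. *)
Lemma sub_connected_del_edge (T : finType) (G : sgraph T) (K : subgraph G)
    (v1 v2 v u : T) :
    sub_connected K -> v \in sub_vertices K -> u \in sub_vertices K ->
    ~~ ([set v1; v2] \subset sub_vertices K) ->
  connect (del_edge G v1 v2) v u.
Proof.
case=> _ Kconn vK uK nK; have := Kconn v u vK uK.
apply: connect_sub => a b /(@sub_adj_edge _ _ K)[aK bK Gab]; apply: connect1.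
rewrite /= /del_edge_rel Gab; apply: contraNneq nK => <-.
by rewrite subUset !sub1set aK.
Qed.

Theorem proposition3p6 (T : finType) (G : sgraph T) (n : nat) (hn : #|T| = n)
    (v1 v2 : T) (hcut : bridge G v1 v2) :
  #|monitored_pairs G [set: T] v1 v2| = 2 * n./2 * uphalf n
  <->
  exists G1 G2 : subgraph G,
    [/\ sub_connected G1 /\ sub_connected G2,
        [disjoint sub_vertices G1 & sub_vertices G2],
        [set: T] = sub_vertices G1 :|: sub_vertices G2,
        (`| #|sub_vertices G1| - #|sub_vertices G2| | <= 1)%N
      & [/\ v1 \in sub_vertices G1, v2 \in sub_vertices G2
          & connected_by_bridge G1 G2 v1 v2]].
Proof.
pose D := del_edge G v1 v2.
pose A := [set u | connect D v1 u]; pose B := [set u | connect D v2 u].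
have v1A : v1 \in A by rewrite inE.
have v2B : v2 \in B by rewrite inE.
have AB : [disjoint A & B] by apply: disjoint_sides.
have cardAB : #|A| + #|B| = #|A :|: B|.
  by rewrite cardsU (disjoint_setI0 AB) cards0 subn0.
have n_gt1 : 1 < n.
  rewrite -hn; apply/card_gt1P; exists v1, v2; split=> //.
  by case/andP: hcut => Gv _; apply: contraTneq Gv => ->; rewrite adj_irrefl.
have le_n : #|A| + #|B| <= n by rewrite cardAB -hn max_card.
rewrite card_monitored_pairs // -/A -/B -mulnA.
have -> : 2 * (#|A| * #|B|) = 2 * (n./2 * uphalf n) <-> #|A| * #|B| = n./2 * uphalf n.
  by split=> [|->] // /eqP; rewrite eqn_pmul2l // => /eqP.
split=> [/(prod_eq_half_uphalf n_gt1 le_n)[ABn dAB]|].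
  exists (component v1 (@sub_del_edge T G v1 v2)).
  exists (component v2 (@sub_del_edge T G v1 v2)).
  split=> //=; first by split; apply: component_connected.
    (* The two sides cover [T] by counting: their union has [n] elements. *)
    by apply/eqP; rewrite eq_sym eqEcard subsetT cardsT hn -ABn cardAB /=.
  by split=> //; split=> // u w; apply: cut_edge_across.
case=> G1 [G2 [[c1 c2] d12 cover dist12 [v1G1 v2G2 _]]].
have v2G1 : v2 \notin sub_vertices G1.
  by apply/negP=> v2G1; have /pred0P/(_ v2) := d12; rewrite /= v2G1 v2G2.
have v1G2 : v1 \notin sub_vertices G2.
  by apply/negP=> v1G2; have /pred0P/(_ v1) := d12; rewrite /= v1G1 v1G2.
have s1 : sub_vertices G1 \subset A.
  apply/subsetP=> u uG1; rewrite inE; apply: sub_connected_del_edge c1 v1G1 uG1 _.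
  by rewrite subUset !sub1set (negPf v2G1) andbF.
have s2 : sub_vertices G2 \subset B.
  apply/subsetP=> u uG2; rewrite inE; apply: sub_connected_del_edge c2 v2G2 uG2 _.
  by rewrite subUset !sub1set (negPf v1G2).
have card12 : #|sub_vertices G1| + #|sub_vertices G2| = n.
  by rewrite -hn -cardsT cover cardsU (disjoint_setI0 d12) cards0 subn0.
have l1 := subset_leq_card s1; have l2 := subset_leq_card s2.
apply/(prod_eq_half_uphalf n_gt1 le_n).
(* [G1] and [G2] lie in [A] and [B] and already have [n >= #|A| + #|B|] vertices together, so both
   inclusions are tight. *)
have [-> ->] : #|A| = #|sub_vertices G1| /\ #|B| = #|sub_vertices G2| by lia.
by [].
Qed.
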